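(* For each $n\ge1$, let $c_n$ be the number of edges labeled $c$ in a dimer covering of the Sierpiński graph $\Gamma_n$ with the ''Schreier'' labeling, chosen uniformly at random among all dimer coverings of $\Gamma_n$. Then $c_n$ has mean $\mu_n=\frac{3^{n-1}}{4}$ and variance $\sigma_n^2=\frac{3}{16}$. Moreover, the normalized random variable $C_n=(c_n-\mu_n)/\sigma_n$ has distribution $$\begin{cases}\frac34\,\delta_{-1/\sqrt3}+\frac14\,\delta_{\sqrt3} & n\text{ odd},\\ \frac34\,\delta_{1/\sqrt3}+\frac14\,\delta_{-\sqrt3} & n\text{ even},\end{cases}$$ where $\delta_x$ denotes the Dirac mass at $x$.
   Context: Let $a,b,c$ act on ternary words by the recursive rules, valid for any ternary word $w$: - $a(0w)=1w$, $a(1w)=0w$, $a(2w)=2a(w)$; - $b(0w)=2w$, $b(2w)=0w$, $b(1w)=1b(w)$; - $c(1w)=2w$, $c(2w)=1w$, $c(0w)=0c(w)$. Let $\Sigma_n$ be the loopless graph on $\{0,1,2\}^n$ with one edge labeled $s$ for each unordered pair $\{u,s(u)\}$, $s(u)\ne u$. The elementary triangles are, for $w\in\{0,1,2\}^{n-1}$, the vertices $0w,1w,2w$ with edges $0w$–$1w$ (label $a$), $0w$–$2w$ (label $b$), and $1w$–$2w$ (label $c$). $\Gamma_n$ is obtained from $\Sigma_n$ by contracting all edges not in an elementary triangle, keeping labels. Its corners are $0^n,1^n,2^n$. A dimer covering of $\Gamma_n$ is a matching covering every non-corner vertex, and - for $n$ odd, covering exactly $0$ or $2$ corners; - for $n$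 even, covering exactly $1$ or $3$ corners. *)

(* Defs.v *)
From HB Require Import structures.
From mathcomp Require Import all_boot all_order all_algebra.
From mathcomp Require Import all_classical all_reals all_analysis.

Set Implicit Arguments.
Unset Strict Implicit.
Unset Printing Implicit Defensive.

Import Order.TTheory GRing.Theory Num.Theory.

Inductive gen := gen_a | gen_b | gen_c.

Definition ord_of_gen (s : gen) : 'I_3 :=
  match s with
  | gen_a => @Ordinal 3 0 isT
  | gen_b => @Ordinal 3 1 isT
  | gen_c => @Ordinal 3 2 isT
  end.

Definition gen_of_ord (i : 'I_3) : gen :=
  match val i with 0 => gen_a | 1 => gen_b | _ => gen_c end.

Lemma ord_of_genK : cancel ord_of_gen gen_of_ord.
Proof. by case. Qed.

HB.instance Definition _ := Equality.copy gen (can_type ord_of_genK).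
HB.instance Definition _ := Choice.copy gen (can_type ord_of_genK).
HB.instance Definition _ := Countable.copy gen (can_type ord_of_genK).
HB.instance Definition _ := Finite.copy gen (can_type ord_of_genK).

Definition letter := 'I_3.
Definition l0 : letter := @Ordinal 3 0 isT.
Definition l1 : letter := @Ordinal 3 1 isT.
Definition l2 : letter := @Ordinal 3 2 isT.

(* The two letters that a generator exchanges; it fixes the third one. *)
Definition swapped (s : gen) : letter * letter :=
  match s with
  | gen_a => (l0, l1)
  | gen_b => (l0, l2)
  | gen_c => (l1, l2)
  end.

Fixpoint act (s : gen) (w : seq letter) : seq letter :=
  match w with
  | [::] => [::]
  | x :: w' =>
      if x == (swapped s).1 then (swapped s).2 :: w'
      else if x == (swapped s).2 then (swapped s).1 :: w'
      else x :: act s w'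
  end.

Lemma size_act s w : size (act s w) = size w.
Proof.
by elim: w => //= x w IHw; case: ifP => // _; case: ifP => //= _; rewrite IHw.
Qed.

Definition word (n : nat) := n.-tuple letter.

Lemma act_tupleP n s (w : word n) : size (act s w) == n.
Proof. by rewrite size_act size_tuple. Qed.

Definition act_word n s (w : word n) : word n := Tuple (act_tupleP s w).

(* The label and the set of end points. *)
Definition edge (n : nat) := (gen * {set word n})%type.

Definition sigma_edges n : {set edge n} :=
  [set e : edge n | [exists u : word n,
     (act_word e.1 u != u) && (e.2 == [set u; act_word e.1 u])]].

(* For s = a, b, c the edge of the triangle at w labeled s is 0w-1w, 0w-2w,
   1w-2w respectively. *)
Definition triangle_edges n : {set edge n} :=
  [set e : edge n |
    [exists w : word n.-1, [exists u : word n, [exists v : word n,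
      [&& tval u == (swapped e.1).1 :: w,
          tval v == (swapped e.1).2 :: w
        & e.2 == [set u; v]]]]]].

Definition contracted_edges n : {set edge n} :=
  sigma_edges n :\: triangle_edges n.

Definition glued n : rel (word n) :=
  fun u v => [exists s : gen, (s, [set u; v]) \in contracted_edges n].

(* A vertex of Gamma_n is a connected component of the graph of contracted
   edges. *)
Definition gamma_vertex n (u : word n) : {set word n} :=
  [set v | connect (@glued n) u v].

Definition gamma_vertices n : {set {set word n}} :=
  [set gamma_vertex u | u in [set: word n]].

(* The edges of Gamma_n are the edges of Sigma_n that are not contracted; only
   their end points change. *)
Definition gamma_edges n : {set edge n} := sigma_edges n :&: triangle_edges n.

Definition gamma_ends n (e : edge n) : {set {set word n}} :=
  [set gamma_vertex u | u in e.2].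

Definition corners n : {set {set word n}} :=
  [set gamma_vertex [tuple of nseq n x] | x in [set: letter]].

Definition is_matching n (M : {set edge n}) : bool :=
  (M \subset gamma_edges n) &&
  [forall e in M, forall f in M,
     (e != f) ==> [disjoint gamma_ends e & gamma_ends f]].

Definition covers n (M : {set edge n}) (x : {set word n}) : bool :=
  [exists e in M, x \in gamma_ends e].

Definition covered_corners n (M : {set edge n}) : nat :=
  #|[set x in corners n | covers M x]|.

Definition is_dimer_covering n (M : {set edge n}) : bool :=
  [&& is_matching M,
      [forall x in gamma_vertices n :\: corners n, covers M x]
    & covered_corners M \in if odd n then [:: 0; 2] else [:: 1; 3]].

Definition dimer_coverings n : {set {set edge n}} :=
  [set M | is_dimer_covering M].

Local Open Scope classical_set_scope.
Local Open Scope ring_scope.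

(* The sample space of all sets of edges, with its discrete sigma-algebra; the
   probability below is carried by the dimer coverings. *)
Definition configuration (n : nat) : Type := {set edge n}.

HB.instance Definition _ n := Choice.on (configuration n).
HB.instance Definition _ n :=
  isPointed.Build (configuration n) (finset.set0 : {set edge n}).
HB.instance Definition _ n := @isMeasurable.Build default_measure_display
  (configuration n) discrete_measurable discrete_measurable0
  discrete_measurableC discrete_measurableU.

Definition dimer_event n : set (configuration n) :=
  [set M | (M : {set edge n}) \in dimer_coverings n].

Lemma measurable_dimer_event n : measurable (@dimer_event n).
Proof. by []. Qed.

(* Counting measure on the dimer coverings, normalized to total mass 1.  The
   second argument of [mnormalize] is a fallback for measures of mass 0 or +oo;
   it plays no role since dimer coverings exist. *)
Definition uniform_dimer (R : realType) n : probability (configuration n) R :=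
  mnormalize (mrestr (@counting (configuration n) R) (@measurable_dimer_event n))
    (dirac (point : configuration n)).

Definition c_count (R : realType) n (M : configuration n) : R :=
  #|[set e in (M : {set edge n}) | e.1 == gen_c]%SET|%:R.

HB.instance Definition _ (R : realType) n :=
  isMeasurableFun.Build _ _ _ _ (@c_count R n) (fun _ _ _ => I).

Definition normalized_c_count (R : realType) n (mu sigma : R)
    (M : configuration n) : R :=
  (c_count R M - mu) / sigma.

HB.instance Definition _ (R : realType) n (mu sigma : R) :=
  isMeasurableFun.Build _ _ _ _ (@normalized_c_count R n mu sigma)
    (fun _ _ _ => I).

(* Main.v *)
Require Import Defs.
From HB Require Import structures.
From mathcomp Require Import all_boot all_order all_algebra.
From mathcomp Require Import all_classical all_reals all_analysis.
From mathcomp Require Import measurable_realfun zify ring lra.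

(** Gluing preserves the first letter of a word: it exchanges [x :: w] with
    [x :: act s w], where [s] is the generator fixing [x].  So a dimer covering
    is a choice of a state (empty, or one edge) in each elementary triangle, with
    one vertex covered in each glued pair, and the number of covered vertices
    with first letter [x] is determined by whether the corner [x...x] is covered.
    If [bx] is 1 when the vertex [x :: w] is covered and 0 otherwise, then
    (b1 + b2 - b0) / 2 is 1 when the triangle at [w] contains a matched edge
    labeled c and 0 otherwise; summing over all triangles writes c_n as an affine
    function of the coverage of the three corners.  States form a
    Klein four-group, which acts on coverings by simultaneous translation in all
    triangles and hence makes the four admissible corner configurations equally
    likely. *)

Set Implicit Arguments.
Unset Strict Implicit.
Unset Printing Implicit Defensive.

Import Order.TTheory GRing.Theory Num.Theory.

(** * Words and the three generators *)

Definition fixer (x : letter) : gen :=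
  match val x with 0 => gen_c | 1 => gen_b | _ => gen_a end.

Definition cons_word m (x : letter) (w : word m) : word m.+1 :=
  [tuple of x :: w].

Lemma cons_word_inj m x y (w w' : word m) :
  cons_word x w = cons_word y w' -> x = y /\ w = w'.
Proof. by move=> /(congr1 val)/= [-> /val_inj ->]. Qed.

Lemma cons_wordP m (u : word m.+1) : exists x w, u = cons_word x w.
Proof. by case/tupleP: u => x w; exists x, w. Qed.

Lemma letter_cases (P : letter -> Type) : P l0 -> P l1 -> P l2 -> forall x, P x.
Proof.
move=> P0 P1 P2 [[|[|[|//]]] lx].
- by rewrite (_ : Ordinal lx = l0) //; apply: val_inj.
- by rewrite (_ : Ordinal lx = l1) //; apply: val_inj.
- by rewrite (_ : Ordinal lx = l2) //; apply: val_inj.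
Qed.

Lemma actK s : involutive (act s).
Proof.
elim=> //= x w IHw.
by case: s IHw => IHw; elim/letter_cases: x => //=; rewrite IHw.
Qed.

Lemma act_wordK m s : involutive (@act_word m s).
Proof. by move=> w; apply/val_inj/actK. Qed.

(** [fixer x] passes over every leading [x] and exchanges the first other letter, so a word is fixed
    only if no other letter occurs. *)
Lemma act_eqP x w : reflect (w = nseq (size w) x) (act (fixer x) w == w).
Proof.
elim: w => [|y w IHw] /=; first exact: ReflectT.
elim/letter_cases: x IHw => IHw; elim/letter_cases: y => //=;
  (try by apply: ReflectF);
  by rewrite eqseq_cons eqxx /=; apply: (iffP IHw) => [->|[->]]; rewrite !size_nseq.
Qed.

Definition tnseq m (x : letter) : word m := [tuple of nseq m x].

Lemma act_word_eq m x (w : word m) :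
  (act_word (fixer x) w == w) = (w == tnseq m x).
Proof.
apply/eqP/eqP => [/(congr1 val)/= /eqP/act_eqP e|e].
  by apply/val_inj => /=; rewrite e size_tuple.
by apply/val_inj/eqP/act_eqP; rewrite e /= size_nseq.
Qed.

(** The first two cases move along an edge of an elementary triangle. In the third the first letter
    is kept, which is the only way to obtain a contracted edge. *)
Lemma act_head s x w :
  [\/ x = (swapped s).1 /\ act s (x :: w) = (swapped s).2 :: w,
      x = (swapped s).2 /\ act s (x :: w) = (swapped s).1 :: w |
      s = fixer x /\ act s (x :: w) = x :: act s w].
Proof.
by case: s; elim/letter_cases: x;
  ((by constructor 1) || (by constructor 2) || (by constructor 3)).
Qed.

Lemma fixer_swapped s x :
  s = fixer x -> x != (swapped s).1 /\ x != (swapped s).2.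
Proof. by move=> ->; elim/letter_cases: x. Qed.

Lemma set2_eqP (T : finType) (a b c d : T) :
  [set a; b] = [set c; d] -> (a = c /\ b = d) \/ (a = d /\ b = c).
Proof.
move=> e.
have /set2P ha : a \in [set c; d] by rewrite -e set21.
have /set2P hb : b \in [set c; d] by rewrite -e set22.
have /set2P hc : c \in [set a; b] by rewrite e set21.
have /set2P hd : d \in [set a; b] by rewrite e set22.
by case: ha; case: hb; case: hc; case: hd; intros; subst; auto.
Qed.

(** * Elementary triangles and the edges of Gamma_n *)

Definition triangle_edge m (s : gen) (w : word m) : edge m.+1 :=
  (s, [set cons_word (swapped s).1 w; cons_word (swapped s).2 w]).

Lemma triangle_edgesP m (e : edge m.+1) :
  reflect (exists s w, e = @triangle_edge m s w) (e \in triangle_edges m.+1).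
Proof.
rewrite inE; apply: (iffP existsP) => [[w]|[s [w ->]]].
  move=> /existsP[u /existsP[v /and3P[/eqP eu /eqP ev /eqP e2]]].
  exists e.1, w; case: e eu ev e2 => s A /= eu ev ->.
  by congr (_, [set _; _]); apply: val_inj.
exists w; apply/existsP; exists (cons_word (swapped s).1 w).
by apply/existsP; exists (cons_word (swapped s).2 w); rewrite !eqxx.
Qed.

Lemma sigma_edgesP n s (u v : word n) :
  reflect (u != v /\ v = act_word s u) ((s, [set u; v]) \in sigma_edges n).
Proof.
rewrite inE /=; apply: (iffP existsP) => [[u' /andP[nu /eqP /set2_eqP]]|[nuv ev]].
  by case=> -[-> ->]; split; rewrite // ?act_wordK // eq_sym.
by exists u; rewrite -ev eq_sym nuv eqxx.
Qed.

Lemma triangle_edge_sigma m s (w : word m) :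
  triangle_edge s w \in sigma_edges m.+1.
Proof.
apply/sigma_edgesP; split; last by apply/val_inj => /=; rewrite eqxx.
by apply/negP => /eqP /cons_word_inj[]; case: s.
Qed.

Lemma gamma_edgesP m (e : edge m.+1) :
  reflect (exists s w, e = @triangle_edge m s w) (e \in gamma_edges m.+1).
Proof.
rewrite finset.in_setI; apply: (iffP andP) => [[_ /triangle_edgesP//]|h].
split; last exact/triangle_edgesP.
by case: h => s [w ->]; apply: triangle_edge_sigma.
Qed.

(** * Contracted edges and the vertices of Gamma_n *)

(** The other end of the contracted edge at [u]; at a corner there is no such edge and the map fixes
    [u]. *)
Definition glue m (u : word m.+1) : word m.+1 :=
  cons_word (thead u) (act_word (fixer (thead u)) [tuple of behead u]).

Lemma glue_cons m x (w : word m) :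
  glue (cons_word x w) = cons_word x (act_word (fixer x) w).
Proof. by rewrite /glue theadE; apply: val_inj. Qed.

Lemma glueK m : involutive (@glue m).
Proof.
by move=> u; have [x [w ->]] := cons_wordP u; rewrite !glue_cons act_wordK.
Qed.

Lemma glue_neq m x (w : word m) :
  (glue (cons_word x w) != cons_word x w) = (w != tnseq m x).
Proof.
rewrite glue_cons -act_word_eq; congr (~~ _).
by apply/eqP/eqP => [/cons_word_inj[]|->].
Qed.

Lemma tnseqS m x : tnseq m.+1 x = cons_word x (tnseq m x).
Proof. exact: val_inj. Qed.

Lemma act_tnseq m x : act_word (fixer x) (tnseq m x) = tnseq m x.
Proof. by apply/eqP; rewrite act_word_eq. Qed.

Lemma glue_tnseq m x : glue (tnseq m.+1 x) = tnseq m.+1 x.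
Proof. by rewrite tnseqS glue_cons act_tnseq. Qed.

(** A generator that changes the first letter runs along a triangle edge, so only [fixer x] can
    label a contracted edge at [x :: w]. Conversely that edge lies in no triangle, since the ends of
    a triangle edge begin with letters that its label exchanges. *)
Lemma gluedE m (u v : word m.+1) : glued u v = (v == glue u) && (u != v).
Proof.
have [x [w ->]] := cons_wordP u; rewrite glue_cons.
apply/existsP/andP => [[s]|[/eqP -> nu]].
  rewrite finset.in_setD => /andP[nT /sigma_edgesP[nu ev]]; split=> //.
  have [[ex ew]|[ex ew]|[es ew]] := act_head s x w.
  - case/triangle_edgesP: nT; exists s, w; congr (_, [set cons_word _ _; _]) => //.
    by rewrite ev; apply: val_inj.
  - case/triangle_edgesP: nT; exists s, w; rewrite finset.setUC.
    congr (_, [set _; cons_word _ _]) => //.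
    by rewrite ev; apply: val_inj.
  - by apply/eqP; rewrite ev; apply: val_inj; rewrite /= -es.
exists (fixer x); have [nx1 nx2] := fixer_swapped (erefl (fixer x)).
rewrite finset.in_setD; apply/andP; split; last first.
  apply/sigma_edgesP; split=> //; apply: val_inj => /=.
  by rewrite (negPf nx1) (negPf nx2).
apply/negP => /triangle_edgesP[s [w' [es]]]; rewrite -es.
move=> /set2_eqP[] [/cons_word_inj[ex _] _].
  by rewrite {1}ex eqxx in nx1.
by rewrite {1}ex eqxx in nx2.
Qed.

Lemma mem_gamma_vertex m (u v : word m.+1) :
  (v \in gamma_vertex u) = (v == u) || (v == glue u).
Proof.
rewrite inE; apply/idP/idP => [/connectP[p pp ->]|].
  (* As [glue] is an involution, a path of contracted edges never leaves the pair of [u] and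
     [glue u]. *)
  have cl : forall p u', (u' == u) || (u' == glue u) -> path (@glued m.+1) u' p ->
     (last u' p == u) || (last u' p == glue u).
    elim=> [//|y q IHq] u' hu' /= /andP[]; rewrite gluedE => /andP[/eqP -> _].
    apply: IHq; case/orP: hu' => /eqP ->; rewrite ?glueK eqxx ?orbT //.
  by apply: cl pp; rewrite eqxx.
case/orP => /eqP ->; first exact: connect0.
have [->|nu] := eqVneq (glue u) u; first exact: connect0.
by apply: connect1; rewrite gluedE eqxx eq_sym.
Qed.

Lemma gamma_vertexP m (u v : word m.+1) :
  gamma_vertex u = gamma_vertex v <-> (v = u \/ v = glue u).
Proof.
split=> [e|].
  have : v \in gamma_vertex u by rewrite e mem_gamma_vertex eqxx.
  by rewrite mem_gamma_vertex => /orP[]/eqP; auto.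
case=> -> //; apply/finset.setP => z; rewrite !mem_gamma_vertex glueK orbC //.
Qed.

Lemma gamma_endsP m (e : edge m.+1) (u : word m.+1) :
  (gamma_vertex u \in gamma_ends e) = (u \in e.2) || (glue u \in e.2).
Proof.
apply/imsetP/orP => [[v ve /gamma_vertexP[]<-]|[]]; auto.
  by exists u.
by exists (glue u) => //; apply/gamma_vertexP; right.
Qed.

Lemma cornersP m (u : word m.+1) :
  (gamma_vertex u \in corners m.+1) = (glue u == u).
Proof.
apply/imsetP/eqP => [[x _ /gamma_vertexP]|].
  rewrite -/(tnseq _ _) => -[] eu; first by rewrite -eu glue_tnseq.
  by rewrite -(glueK u) -eu !glue_tnseq.
have [x [w ->]] := cons_wordP u.
move=> gu; have := glue_neq x w; rewrite gu eqxx => /esym/negbFE/eqP ->.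
by exists x => //; rewrite -tnseqS.
Qed.

(** * Matchings encoded as fields of states *)

(* Whether the vertices [l0 :: w] and [l1 :: w] of the triangle at [w] are
   covered.  An edge covers two vertices, so [l2 :: w] is covered if and only if
   exactly one of these is. *)
Definition state := (bool * bool)%type.

(** These are the three nonzero linear forms on the plane over the field with two elements. *)
Definition covered_letter (x : letter) (v : state) : bool :=
  match val x with 0 => v.1 | 1 => v.2 | _ => v.1 (+) v.2 end.

Definition state_of (s : gen) : state :=
  match s with
  | gen_a => (true, true)
  | gen_b => (true, false)
  | gen_c => (false, true)
  end.

Lemma state_of_inj : injective state_of.
Proof. by do 2 case. Qed.

Lemma covered_letter_state_of x s :
  covered_letter x (state_of s) = (x == (swapped s).1) || (x == (swapped s).2).
Proof. by elim/letter_cases: x; case: s. Qed.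

Lemma covered_letterP x v :
  covered_letter x v -> exists s, v = state_of s.
Proof.
case: v => [[] []] h; [by exists gen_a|by exists gen_b|by exists gen_c|].
by elim/letter_cases: x h.
Qed.

Lemma triangle_edge_inj m s s' (w w' : word m) :
  triangle_edge s w = triangle_edge s' w' -> s = s' /\ w = w'.
Proof. by case=> -> /set2_eqP[] [/cons_word_inj[_ ->]]. Qed.

Lemma mem_triangle_edge m x s (w w' : word m) :
  (cons_word x w \in (triangle_edge s w').2)
    = (w == w') && covered_letter x (state_of s).
Proof.
rewrite covered_letter_state_of; apply/set2P/andP.
  by case=> /cons_word_inj[-> ->]; rewrite !eqxx ?orbT.
by case=> /eqP -> /orP[] /eqP ->; [left|right].
Qed.

(** The exclusive or demands exactly one covered word in each glued pair: at least one by the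
    covering condition, at most one by the matching condition. Constant words are the corners and
    stay free. *)
Definition admissible m (f : {ffun word m -> state}) : bool :=
  [forall x, [forall w, (w != tnseq m x) ==>
    (covered_letter x (f w) (+) covered_letter x (f (act_word (fixer x) w)))]].

Definition edges_of m (f : {ffun word m -> state}) : {set edge m.+1} :=
  [set triangle_edge p.1 p.2 | p in [set p : gen * word m | f p.2 == state_of p.1]].

Lemma mem_edges_of m (f : {ffun word m -> state}) s w :
  (triangle_edge s w \in edges_of f) = (f w == state_of s).
Proof.
apply/imsetP/idP => [[[s' w']]|fw]; last by exists (s, w); rewrite ?inE.
by rewrite inE /= => fw' /triangle_edge_inj[-> ->].
Qed.

Lemma edges_ofP m (f : {ffun word m -> state}) e :
  reflect (exists s w, f w = state_of s /\ e = triangle_edge s w)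
    (e \in edges_of f).
Proof.
apply: (iffP imsetP) => [[[s w]]|[s [w [fw ->]]]].
  by rewrite inE /= => /eqP fw ->; exists s, w.
by exists (s, w); rewrite ?inE ?fw.
Qed.

Lemma edges_of_inj m : injective (@edges_of m).
Proof.
move=> f g efg; apply/ffunP => w.
have E s : (f w == state_of s) = (g w == state_of s).
  by rewrite -!mem_edges_of efg.
move: (E gen_a) (E gen_b) (E gen_c).
by case: (f w) => [[] []]; case: (g w) => [[] []].
Qed.

Lemma incident_edges_of m (f : {ffun word m -> state}) x w :
  covered_letter x (f w)
    <-> exists2 e, e \in edges_of f & cons_word x w \in e.2.
Proof.
split=> [h|[e /edges_ofP[s [w' [fw' ->]]]]].
  have [s fw] := covered_letterP h; exists (triangle_edge s w).
    by rewrite mem_edges_of fw.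
  by rewrite mem_triangle_edge eqxx -fw.
by rewrite mem_triangle_edge => /andP[/eqP ->]; rewrite fw'.
Qed.

Lemma covers_edges_of m (f : {ffun word m -> state}) x w :
  covers (edges_of f) (gamma_vertex (cons_word x w))
    = covered_letter x (f w) || covered_letter x (f (act_word (fixer x) w)).
Proof.
apply/existsP/orP => [[e /andP[eM]]|].
  rewrite gamma_endsP glue_cons => /orP[] h; [left|right];
  by apply/incident_edges_of; exists e.
by case=> /incident_edges_of[e eM h]; exists e;
  rewrite eM gamma_endsP glue_cons h ?orbT.
Qed.

Lemma admissibleP m (f : {ffun word m -> state}) :
  reflect (forall x w, w != tnseq m x ->
    covered_letter x (f (act_word (fixer x) w)) = ~~ covered_letter x (f w))
    (admissible f).
Proof.
apply: (iffP forallP) => [h x w nw|h x].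
  by have /forallP/(_ w)/implyP/(_ nw) := h x; do 2 case: covered_letter.
by apply/forallP => w; apply/implyP => /h ->; case: covered_letter.
Qed.

Lemma covered_corners_edges_of m (f : {ffun word m -> state}) :
  covered_corners (edges_of f) = (\sum_x covered_letter x (f (tnseq m x)))%N.
Proof.
rewrite /covered_corners.
have -> : [set x in corners m.+1 | covers (edges_of f) x] =
    [set gamma_vertex (tnseq m.+1 x)
       | x in [set x | covered_letter x (f (tnseq m x))]].
  have cov x : covers (edges_of f) (gamma_vertex (tnseq m.+1 x))
     = covered_letter x (f (tnseq m x)).
    by rewrite tnseqS covers_edges_of act_tnseq orbb.
  apply/finset.setP => X; rewrite inE; apply/andP/imsetP.
    by case=> /imsetP[x _ ->]; rewrite cov => h; exists x; rewrite ?inE.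
  case=> x; rewrite inE -cov => h ->; split=> //.
  by apply/imsetP; exists x.
(* Distinct letters give distinct corners of Gamma_n, because gluing fixes constant words. *)
rewrite card_imset; last first.
  by move=> x y /gamma_vertexP[]; rewrite ?glue_tnseq !tnseqS => /cons_word_inj[].
by rewrite -sum1dep_card big_mkcond; apply: eq_bigr => x _; case: covered_letter.
Qed.

(** * Counting covered vertices and edges labeled c *)

(** Twice the sum adds [w] to its glued partner: each of the [3 ^ m - 1] nonconstant words
    contributes 1, and the corner contributes twice its own coverage. The 1 on the left avoids a
    truncated subtraction. *)
Lemma sum_covered_letter m (f : {ffun word m -> state}) x : admissible f ->
  (2 * (\sum_w covered_letter x (f w)) + 1
     = 3 ^ m + 2 * covered_letter x (f (tnseq m x)))%N.
Proof.
move=> /admissibleP af.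
have e : (\sum_w covered_letter x (f w)
    = \sum_w covered_letter x (f (act_word (fixer x) w)))%N.
  by rewrite (reindex_inj (inv_inj (@act_wordK m (fixer x)))).
rewrite mul2n -addnn {2}e -big_split /= (bigD1 (tnseq m x)) //=.
rewrite act_tnseq (eq_bigr (fun=> 1%N)); last first.
  by move=> w /af ->; case: covered_letter.
rewrite sum1_card (cardC1 (tnseq m x)) card_tuple card_ord.
have : (0 < 3 ^ m)%N by rewrite expn_gt0.
lia.
Qed.

Lemma letter_sum (F : letter -> nat) : (\sum_x F x = F l0 + F l1 + F l2)%N.
Proof.
rewrite !big_ord_recr big_ord0 /= add0n.
by congr (F _ + F _ + F _)%N; apply: val_inj.
Qed.

Lemma exp3_mod4 m : (3 ^ m %% 4 = if odd m then 3 else 1)%N.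
Proof.
elim: m => // m IHm; rewrite expnS -modnMmr IHm /=; by case: odd.
Qed.

(** Each triangle has zero or two covered vertices. With E nonempty triangles and S covered corners,
    adding [sum_covered_letter] over the letters gives [4 * E + 3 = 3 * 3 ^ m + 2 * S]; modulo 4
    this fixes the parity of S. *)
Lemma odd_corners m (f : {ffun word m -> state}) : admissible f ->
  odd (\sum_x covered_letter x (f (tnseq m x))) = odd m.
Proof.
move=> af.
have e : (\sum_w covered_letter l0 (f w) + \sum_w covered_letter l1 (f w)
    + \sum_w covered_letter l2 (f w) = 2 * \sum_w (f w != (false, false)))%N.
  rewrite big_distrr /= -!big_split /=; apply: eq_bigr => w _.
  by case: (f w) => [[] []].
have := sum_covered_letter l0 af; have := sum_covered_letter l1 af.
have := sum_covered_letter l2 af; have := exp3_mod4 m.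
rewrite letter_sum; move: (3 ^ m)%N e => p.
do 4![move: (\sum_w _)%N => ?].
by case: (odd m); do 3![case: (covered_letter _ (f (tnseq m _)))] => /=; lia.
Qed.

Lemma c_edges_of m (f : {ffun word m -> state}) : admissible f ->
  (4 * #|[set e in edges_of f | e.1 == gen_c]|
     + 2 * covered_letter l0 (f (tnseq m l0)) + 1
   = 3 ^ m + 2 * covered_letter l1 (f (tnseq m l1))
     + 2 * covered_letter l2 (f (tnseq m l2)))%N.
Proof.
move=> af.
have -> : [set e in edges_of f | e.1 == gen_c] =
    [set triangle_edge gen_c w | w in [set w | f w == (false, true)]].
  apply/finset.setP => e; rewrite inE; apply/andP/imsetP.
    by case=> /edges_ofP[s [w [fw ->]]] /= /eqP es; exists w; rewrite ?inE ?fw es.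
  by case=> w; rewrite inE => fw ->; rewrite mem_edges_of.
rewrite card_imset; last by move=> w w' /triangle_edge_inj[].
(* In one triangle b1 + b2 - b0 is 2 for the edge labeled c and 0 in the other three states; b0 is
   moved to the left to stay in the naturals. *)
have e : (2 * #|[set w | f w == (false, true)]| + \sum_w covered_letter l0 (f w)
  = \sum_w covered_letter l1 (f w) + \sum_w covered_letter l2 (f w))%N.
  rewrite -sum1dep_card big_mkcond /= big_distrr /= -!big_split /=.
  by apply: eq_bigr => w _; case: (f w) => [[] []].
have := sum_covered_letter l0 af; have := sum_covered_letter l1 af.
have := sum_covered_letter l2 af; move: (3 ^ m)%N e => p.
do 3![move: (\sum_w _)%N => ?]; lia.
Qed.

(** * Dimer coverings are the admissible fields *)

Lemma matching_eq n (M : {set edge n}) (e g : edge n) X :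
  is_matching M -> e \in M -> g \in M ->
  X \in gamma_ends e -> X \in gamma_ends g -> e = g.
Proof.
case/andP=> _ /forall_inP h eM gM Xe Xg; apply/eqP/negPn/negP => neg.
have /forall_inP/(_ g gM)/implyP/(_ neg)/pred0P/(_ X) := h e eM.
by rewrite /= Xe Xg.
Qed.

Lemma edges_of_dimer m (f : {ffun word m -> state}) :
  admissible f -> edges_of f \in dimer_coverings m.+1.
Proof.
move=> af; have /admissibleP alt := af.
rewrite inE; apply/and3P; split.
- apply/andP; split.
    apply/fintype.subsetP => e /edges_ofP[s [w [_ ->]]].
    by apply/gamma_edgesP; exists s, w.
  apply/forall_inP => e eM; apply/forall_inP => g gM; apply/implyP => neg.
  apply/negPn/negP => /pred0Pn[X /andP[/imsetP[u ue ->]]] /=.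
  rewrite gamma_endsP; have [x [w eu]] := cons_wordP u; rewrite eu in ue * => ug.
  have cw : covered_letter x (f w) by apply/incident_edges_of; exists e.
  (* The glued partner of a covered word is uncovered, so [g] meets the common vertex at the same
     word as [e]. Both edges then lie in the triangle at [w], whose state allows only one. *)
  have {}ug : cons_word x w \in g.2.
    have [ew|nw] := eqVneq w (tnseq m x).
      by move: ug; rewrite ew glue_cons act_tnseq orbb.
    case/orP: ug => //; rewrite glue_cons => ug.
    have : covered_letter x (f (act_word (fixer x) w)).
      by apply/incident_edges_of; exists g.
    by rewrite alt // cw.
  case/negP: neg; case/edges_ofP: eM ue => [s [w1 [f1 ->]]].
  case/edges_ofP: gM ug => [t [w2 [f2 ->]]].
  rewrite !mem_triangle_edge => /andP[/eqP e2 _] /andP[/eqP e1 _].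
  by move: f1 f2; rewrite -e1 -e2 => -> /state_of_inj ->.
- apply/forall_inP => X; rewrite finset.in_setD => /andP[nc /imsetP[u _ eX]].
  move: nc; rewrite {}eX cornersP; have [x [w ->]] := cons_wordP u.
  by rewrite glue_neq covers_edges_of => /alt ->; case: covered_letter.
(* Among 0 to 3 corners, the parity alone selects 0 or 2, respectively 1 or 3; here n is [m.+1]. *)
have := odd_corners af; rewrite covered_corners_edges_of letter_sum /=.
by case: (odd m); do 3![case: (covered_letter _ (f (tnseq m _)))].
Qed.

Lemma dimer_edges_of m (M : {set edge m.+1}) : M \in dimer_coverings m.+1 ->
  exists2 f : {ffun word m -> state}, admissible f & M = edges_of f.
Proof.
rewrite inE => /and3P[matM /forall_inP cover _].
have [/fintype.subsetP subM _] := andP matM.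
pose cov x w := [exists e in M, cons_word x w \in e.2].
have covP s w x : triangle_edge s w \in M ->
    cov x w = covered_letter x (state_of s).
  move=> sM; apply/existsP/idP => [[g /andP[gM]]|cx]; last first.
    by exists (triangle_edge s w); rewrite sM mem_triangle_edge eqxx.
  have /gamma_edgesP[t [w' eg]] := subM _ gM.
  rewrite eg mem_triangle_edge => /andP[/eqP ew]; rewrite -ew in eg => {w' ew}.
  (* Any two edges of a triangle share a vertex, so a matching contains at most one of them. *)
  have [y ys yt] : exists2 y, covered_letter y (state_of s)
                            & covered_letter y (state_of t).
    by case: (s); case: (t);
      ((by exists l0) || (by exists l1) || (by exists l2)).
  have : triangle_edge s w = triangle_edge t w.
    apply: (matching_eq (X := gamma_vertex (cons_word y w)) matM) => //.
    - by rewrite -eg.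
    - by rewrite gamma_endsP mem_triangle_edge eqxx ys.
    - by rewrite gamma_endsP mem_triangle_edge eqxx yt.
  by case/triangle_edge_inj=> ->.
pose f := [ffun w => (cov l0 w, cov l1 w)].
have fP s w : triangle_edge s w \in M -> f w = state_of s.
  by move=> sM; rewrite ffunE !(covP s) //; case: (s).
have eM : M = edges_of f.
  apply/finset.setP => e; apply/idP/edges_ofP => [eM|[s [w [fw ->]]]].
    have /gamma_edgesP[s [w ee]] := subM _ eM; exists s, w; split=> //.
    by apply: fP; rewrite -ee.
  have [x] : exists x, cov x w.
    have := fw; rewrite ffunE; case: (s) => -[h1 h2];
    by [exists l0|exists l0|exists l1].
  case/existsP=> g /andP[gM]; have /gamma_edgesP[t [w' eg]] := subM _ gM.
  rewrite eg mem_triangle_edge => /andP[/eqP ew _]; rewrite -ew in eg.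
  have tM : triangle_edge t w \in M by rewrite -eg.
  by have := fP _ _ tM; rewrite fw => /state_of_inj ->.
exists f => //; apply/admissibleP => x w nw.
have : gamma_vertex (cons_word x w) \in gamma_vertices m.+1 :\: corners m.+1.
  rewrite finset.in_setD cornersP glue_neq nw /=.
  by apply/imsetP; exists (cons_word x w).
move=> /cover; rewrite eM covers_edges_of.
(* If both words of the pair were covered, the two covering edges would share a vertex of Gamma_n
   and coincide. A single edge lies in one triangle, which would force [w] to be fixed and hence
   constant. *)
case c1: (covered_letter x (f w)); case c2: (covered_letter x _) => //= _.
have /incident_edges_of[e1 m1 u1] := c1; have /incident_edges_of[e2 m2 u2] := c2.
have e12 : e1 = e2.
  rewrite -eM in m1 m2.
  apply: (matching_eq (X := gamma_vertex (cons_word x w)) matM) => //.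
    by rewrite gamma_endsP u1.
  by rewrite gamma_endsP glue_cons u2 orbT.
case/edges_ofP: m1 e12 u1 => s [w' [_ ->]] e12; rewrite -e12 in u2; move: u2.
rewrite !mem_triangle_edge => /andP[/eqP ew' _] /andP[/eqP ew _].
by move: nw; rewrite -act_word_eq ew' ew eqxx.
Qed.

Lemma dimer_coveringsE m :
  dimer_coverings m.+1 = [set edges_of f | f in [set f | @admissible m f]].
Proof.
apply/finset.setP => M; apply/idP/imsetP.
  by case/dimer_edges_of=> f af ->; exists f; rewrite ?inE.
by case=> f; rewrite inE => /edges_of_dimer h ->.
Qed.

(** * Translations and equidistribution of the corner states *)

Definition add_state (u v : state) : state := (u.1 (+) v.1, u.2 (+) v.2).

Lemma add_stateK v : involutive (add_state^~ v).
Proof. by case: v => [[] []] [[] []]. Qed.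

Lemma covered_letter_add x u v :
  covered_letter x (add_state u v) = covered_letter x u (+) covered_letter x v.
Proof. by elim/letter_cases: x; case: u => [[] []]; case: v => [[] []]. Qed.

Definition translate m (v : state) (f : {ffun word m -> state}) :
  {ffun word m -> state} := [ffun w => add_state (f w) v].

Lemma translateK m v : involutive (@translate m v).
Proof. by move=> f; apply/ffunP => w; rewrite !ffunE add_stateK. Qed.

(** Coverage is additive in the state, so a translation flips both words of a glued pair or
    neither. *)
Lemma admissible_translate m v (f : {ffun word m -> state}) :
  admissible f -> admissible (translate v f).
Proof.
move=> /admissibleP af; apply/admissibleP => x w /af.
by rewrite !ffunE !covered_letter_add => ->; rewrite addNb.
Qed.

(* The number of each letter modulo 2: exchanging the two letters other than
   [x] in one position always flips the coverage of [x]. *)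
Definition parity_field m : {ffun word m -> state} :=
  [ffun w : word m => (odd (count_mem l1 w), odd (count_mem l2 w))].

(** This exhibits a dimer covering, which makes the uniform law meaningful. *)
Lemma admissible_parity_field m : admissible (parity_field m).
Proof.
pose p (w : seq letter) := (odd (count_mem l1 w), odd (count_mem l2 w)).
have flip x w : act (fixer x) w != w ->
    covered_letter x (p (act (fixer x) w)) = ~~ covered_letter x (p w).
  elim: w => // y w IHw.
  elim/letter_cases: x IHw => IHw; elim/letter_cases: y => //=;
  rewrite ?eqseq_cons ?eqxx /= /covered_letter /p /= ?add0n => nw;
  rewrite ?negbK ?addNb ?addbN ?negbK //.
  by have := IHw nw; rewrite /covered_letter /p /= => ->; rewrite negbK.
apply/admissibleP => x w; rewrite -act_word_eq !ffunE; exact: flip.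
Qed.

(* By [odd_corners] the state of the third corner is determined by these two. *)
Definition corner_state m (f : {ffun word m -> state}) : bool * bool :=
  (covered_letter l1 (f (tnseq m l1)), covered_letter l2 (f (tnseq m l2))).

Definition fiber m (v : bool * bool) : {set {ffun word m -> state}} :=
  [set f | admissible f && (corner_state f == v)].

Lemma card_fiber m u v : #|fiber m u| = #|fiber m v|.
Proof.
have le u' v' : (#|fiber m u'| <= #|fiber m v'|)%N.
  case: u' => a b.
  (* The unique state whose coverages of [l1] and [l2] are the differences between the source and
     target corner states. *)
  pose t : state := (a (+) v'.1 (+) (b (+) v'.2), a (+) v'.1).
  rewrite -(card_imset _ (inv_inj (@translateK m t))); apply: subset_leq_card.
  apply/fintype.subsetP => g /imsetP[f]; rewrite inE => /andP[af /eqP fu] ->.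
  rewrite inE admissible_translate //= /corner_state !ffunE !covered_letter_add.
  move: fu; rewrite /corner_state => -[ea eb].
  rewrite {}/t -ea -eb; case: v' => [[] []] /=;
  by do 2 case: (covered_letter _ (f (tnseq m _))).
by apply/eqP; rewrite eqn_leq !le.
Qed.

Lemma card_admissible m v :
  #|[set f | @admissible m f]| = (4 * #|fiber m v|)%N.
Proof.
rewrite -sum1_card (partition_big (@corner_state m) xpredT) //=.
under eq_bigr => u _.
  rewrite sum1dep_card (_ : [set _ | _] = fiber m u); last first.
    by apply/finset.setP => f; rewrite !inE.
  rewrite (card_fiber m u v).
  over.
by rewrite sum_nat_const card_prod card_bool.
Qed.

(** By [c_edges_of], the count depends only on b1 + b2 - b0 at the corners. For even m this is 2
    when exactly corners 1 and 2 are covered and 0 in the other three cases; for odd m it is -1 when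
    only corner 0 is covered and 1 otherwise. The exceptional class is [rare]. *)
Lemma dimer_c_edges m : exists rare : {set {set edge m.+1}},
  [/\ rare \subset dimer_coverings m.+1,
      #|dimer_coverings m.+1| = (4 * #|rare|)%N, (0 < #|rare|)%N
    & forall M, M \in dimer_coverings m.+1 ->
      let c := #|[set e in M | e.1 == gen_c]| in
      (if odd m then 4 * c + 3 * (M \in rare) = 3 ^ m + (M \notin rare)
       else 4 * c + (M \notin rare) = 3 ^ m + 3 * (M \in rare))%N].
Proof.
have cD := card_admissible m (~~ odd m, ~~ odd m).
exists [set edges_of f | f in fiber m (~~ odd m, ~~ odd m)].
rewrite dimer_coveringsE !card_imset ?cD; try exact: edges_of_inj.
split=> //.
- by apply: imsetS; apply/fintype.subsetP => f; rewrite !inE => /andP[].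
- have : (0 < #|[set f | @admissible m f]|)%N.
    by apply/card_gt0P; exists (parity_field m); rewrite inE admissible_parity_field.
  by rewrite cD muln_gt0.
move=> M /imsetP[f]; rewrite inE => af ->.
rewrite (mem_imset _ _ (@edges_of_inj m)) inE af /=.
have := c_edges_of af; have := odd_corners af; rewrite letter_sum /corner_state.
move: (#|_|) (3 ^ m)%N => c p.
by case: (odd m); do 3![case: (covered_letter _ (f (tnseq m _)))] => //=; lia.
Qed.

Local Open Scope classical_set_scope.
Local Open Scope ring_scope.

(** * The uniform law and two-valued random variables *)

Lemma counting_fin (R : realType) n (A : set (configuration n)) :
  counting A = #|[set M : {set edge n} | `[< A M >]]%SET|%:R%:E :> \bar R.
Proof.
have finA : finite_set A.
  apply: (sub_finite_set (@subsetT _ A)).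
  by apply: (@finite_finset {set edge n}).
rewrite /counting asboolT //; congr (_%:R%:E).
rewrite -(card_uniqP (finmap.fset_uniq (fset_set A))); apply: eq_card => M.
by rewrite inE; apply/idP/asboolP; rewrite (in_fset_set finA) inE.
Qed.

Lemma mnormalizeE d (T : measurableType d) (R : realType)
    (mu : {measure set T -> \bar R}) (P : probability T R) (r : R) (A : set T) :
  mu setT = r%:E -> r != 0 -> mnormalize mu P A = (mu A * r^-1%:E)%E.
Proof. by move=> muT r0; rewrite /mnormalize muT /= orbF eqe (negPf r0). Qed.

Lemma uniform_dimerE (R : realType) n (A : set (configuration n)) :
  (0 < #|dimer_coverings n|)%N ->
  uniform_dimer R n A
    = (#|[set M in dimer_coverings n | `[< A M >]]%SET|%:R
         / #|dimer_coverings n|%:R)%:E.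
Proof.
move=> D0.
have E (B : set (configuration n)) : mrestr (@counting (configuration n) R)
    (@measurable_dimer_event n) B
    = #|[set M in dimer_coverings n | `[< B M >]]%SET|%:R%:E.
  rewrite /mrestr counting_fin; congr (_%:R%:E); apply: eq_card => M.
  rewrite !inE; apply/asboolP/andP => -[h1 h2]; split=> //.
  - by move: h2; rewrite /dimer_event /= inE.
  - exact/asboolP.
  - exact/asboolP.
  - by rewrite /dimer_event /= inE.
have ET : mrestr (@counting (configuration n) R)
    (@measurable_dimer_event n) setT = #|dimer_coverings n|%:R%:E.
  by rewrite E; congr (_%:R%:E); apply: eq_card => M; rewrite !inE asboolT ?andbT.
etransitivity; first apply: (mnormalizeE _ _ ET).
  by rewrite pnatr_eq0 -lt0n.
by rewrite EFinM; congr (_ * _)%E; apply: E.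
Qed.

Lemma uniform_dimer_two_values (R : realType) n
    (rare : {set {set edge n}}) d (T : measurableType d) (X : configuration n -> T)
    (x y : T) (A : set T) :
  rare \subset dimer_coverings n ->
  #|dimer_coverings n| = (4 * #|rare|)%N -> (0 < #|rare|)%N ->
  (forall M, M \in dimer_coverings n -> X M = if M \in rare then x else y) ->
  uniform_dimer R n (X @^-1` A)
    = ((3 / 4)%:E * \d_y A + (1 / 4)%:E * \d_x A)%E.
Proof.
move=> sub cD r0 XE; rewrite uniform_dimerE ?cD ?muln_gt0 //.
have asboolA z : `[< A z >] = (z \in A) by apply/asboolP/idP; rewrite inE.
(* The coverings split into [rare] and its complement, which is three times as large. *)
have -> : #|[set M in dimer_coverings n | `[< (X @^-1` A) M >]]%SET|
    = (#|rare| * (x \in A) + 3 * #|rare| * (y \in A))%N.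
  rewrite -sum1dep_card big_mkcondr /= (big_setID rare) /=.
  rewrite (finset.setIidPr sub); congr (_ + _)%N.
    rewrite (eq_bigr (fun=> (x \in A : nat))); last first.
      move=> M rM; rewrite /preimage /= XE ?(fintype.subsetP sub) // rM.
      by rewrite asboolA; case: (x \in A).
    by rewrite sum_nat_const.
  rewrite (eq_bigr (fun=> (y \in A : nat))); last first.
    move=> M; rewrite finset.in_setD => /andP[/negPf rM DM].
    rewrite /preimage /= XE // rM.
    by rewrite asboolA; case: (y \in A).
  rewrite sum_nat_const cardsD (finset.setIidPr sub) cD; congr (_ * _)%N.
  by rewrite -[X in (_ - X)%N]mul1n -mulnBl.
have r1 : #|rare|%:R != 0 :> R by rewrite pnatr_eq0 -lt0n.
rewrite !diracE -!EFinM -EFinD; congr (_%:E).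
by rewrite natrD !natrM; field.
Qed.

(** The integral is transferred to the law of [X], a combination of two Dirac masses; nonnegativity
    of [f] gives additivity in the measure. *)
Lemma integral_two_values (R : realType) n (rare : {set {set edge n}})
    (X : {RV (uniform_dimer R n) >-> R}) (x y : R) (f : R -> R) :
  rare \subset dimer_coverings n ->
  #|dimer_coverings n| = (4 * #|rare|)%N -> (0 < #|rare|)%N ->
  (forall M, M \in dimer_coverings n -> X M = if M \in rare then x else y) ->
  measurable_fun [set: R] f -> (forall z, 0 <= f z) ->
  (\int[uniform_dimer R n]_M (f (X M))%:E = (3 / 4 * f y + 1 / 4 * f x)%:E)%E.
Proof.
move=> sub cD r0 XE mf f0.
have k1 : 0 <= 3 / 4 :> R by lra.
have k2 : 0 <= 1 / 4 :> R by lra.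
have mf' : measurable_fun setT (EFin \o f) by exact/measurable_EFinP.
have f0' z : (0 <= (EFin \o f) z)%E by rewrite lee_fin.
rewrite -[LHS](ge0_integral_distribution X mf' f0').
rewrite (eq_measure_integral
  (measure_add (mscale (NngNum k1) (dirac y)) (mscale (NngNum k2) (dirac x)))).
  rewrite ge0_integral_measure_add // !ge0_integral_mscale //.
  by rewrite !integral_dirac // !diracT !mul1e.
move=> A _ _; apply: etrans (esym (measure_addE _ _ _)).
exact: (uniform_dimer_two_values R A sub cD r0 XE).
Qed.

(** * Mean, variance and normalized law of the number of edges labeled c *)

Theorem theorem5p2 (R : realType) (n : nat) (hn : (1 <= n)%N) :
  let P : probability (configuration n) R := uniform_dimer R n in
  let mu : R := 3 ^+ n.-1 / 4 in
  let sigma : R := Num.sqrt (3 / 16) in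
  let c : {RV P >-> R} := @c_count R n in
  let C : {RV P >-> R} := @normalized_c_count R n mu sigma in
  let sqrt3 : R := Num.sqrt 3 in
  [/\ ('E_P[c] = mu%:E)%E,
      ('V_P[c] = (3 / 16)%:E)%E
    & forall A : set R, measurable A ->
        distribution P C A =
          (if odd n
           then (3 / 4)%:E * \d_(- (1 / sqrt3))%R A + (1 / 4)%:E * \d_sqrt3 A
           else (3 / 4)%:E * \d_(1 / sqrt3)%R A + (1 / 4)%:E * \d_(- sqrt3)%R A)%E].
Proof.
case: n hn => // m _ P mu sigma c C sqrt3.
have [rare [sub cD r0 cE]] := dimer_c_edges m.
(* The side of the mean on which the rare value lies; since n is [m.+1], odd m means even n. *)
pose e : R := if odd m then -1 else 1.
have cval M : M \in dimer_coverings m.+1 ->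
    c M = if M \in rare then mu + e * (3 / 4) else mu - e / 4.
  move=> /cE; rewrite /= /c /c_count /= /e /mu /=.
  move: (#|_|) => k.
  have nat_eq (i j : nat) : i = j -> i%:R = j%:R :> R by move=> ->.
  case: (odd m) => /nat_eq; rewrite !(natrM, natrD, natrX);
  case: (M \in rare) => /= h; lra.
have e2 : e ^+ 2 = 1 by rewrite /e; case: odd; rewrite ?sqrrN expr1n.
have mu0 : 0 <= mu by rewrite divr_ge0 // exprn_ge0.
(* Both values are nonnegative, the first because some covering attains it. Hence the mean can be
   computed as the integral of the absolute value. *)
have [ge_x ge_y] : 0 <= mu + e * (3 / 4) /\ 0 <= mu - e / 4.
  split.
    have /card_gt0P[M rM] := r0.
    have := cval M (fintype.subsetP sub M rM); rewrite rM => <-; exact: ler0n.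
  rewrite /e; case: (odd m); first by lra.
  suff : 1 / 4 <= mu by lra.
  by rewrite ler_pM2r ?invr_gt0 // exprn_ege1 // ler1n.
have Ec : ('E_P[c] = mu%:E)%E.
  rewrite unlock.
  transitivity (\int[P]_M `|c M|%:E)%E.
    by apply: eq_integral => M _; rewrite ger0_norm // ler0n.
  rewrite (integral_two_values (f := fun z => `|z|) sub cD r0 cval) //.
  by rewrite !ger0_norm //; congr (_%:E); field.
split=> //.
  rewrite /variance unlock Ec /= unlock.
  transitivity (\int[P]_M ((c M - mu) ^+ 2)%:E)%E.
    by apply: eq_integral => M _; rewrite expr2.
  rewrite (integral_two_values (f := fun z => (z - mu) ^+ 2) sub cD r0 cval).
  - congr (_%:E); transitivity (3 / 16 * e ^+ 2); last by rewrite e2 mulr1.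
    by field.
  - by apply: measurable_funX; apply: measurable_funB.
  - by move=> z; rewrite sqr_ge0.
move=> A _; rewrite /distribution /pushforward.
have s3 : sqrt3 ^+ 2 = 3 by rewrite sqr_sqrtr.
have s30 : 0 < sqrt3 by rewrite sqrtr_gt0.
have sE : sigma = sqrt3 / 4.
  rewrite /sigma sqrtrM //; congr (_ * _).
  rewrite sqrtrV // (_ : 16 = 4 ^+ 2); last by rewrite -natrX.
  by rewrite sqrtr_sqr ger0_norm.
(* Dividing the deviations 3e/4 and -e/4 by [sqrt3 / 4] gives these two atoms, as
   [3 / sqrt3 = sqrt3]. *)
rewrite (uniform_dimer_two_values (x := e * sqrt3) (y := - e / sqrt3) R A sub cD r0).
  rewrite /= /e; case: (odd m) => /=; rewrite ?opprK ?mulN1r ?mul1r ?mulNr ?mul1r //.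
move=> M DM; transitivity ((c M - mu) / sigma) => //; rewrite cval // sE.
have sn : sqrt3 != 0 by rewrite gt_eqF.
case: ifP => _.
  transitivity (e * sqrt3 ^+ 2 / sqrt3); last by field.
  by rewrite s3; field.
by field.
Qed.
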